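(* Let $M$ be an $(\epsilon)$-para-Sasakian 3-manifold with structure $(\phi,\xi,\eta,g,\epsilon)$, and let $\mathcal{Z}=S+\psi g$ be its $\mathcal{Z}$ tensor, where $S$ is the Ricci tensor and $\psi$ is an arbitrary scalar function on $M$. Then the following statements are equivalent: (1) $M$ is an Einstein manifold. (2) $M$ is Ricci-symmetric. (3) $M$ is Ricci-semisymmetric. (4) $M$ is $\mathcal{Z}$-semisymmetric.
   Context: An almost para-contact structure on a manifold $M$ consists of a $(1,1)$-tensor field $\phi$, a vector field $\xi$ and a 1-form $\eta$ with $\phi^2=I-\eta\otimes\xi$, $\eta(\xi)=1$, $\phi\xi=0$, $\eta\circ\phi=0$. If $g$ is a semi-Riemannian metric on $M$ with $g(\phi X,\phi Y)=g(X,Y)-\epsilon\,\eta(X)\eta(Y)$ for all vector fields $X,Y$, where $\epsilon=\pm1$ is fixed, then $(\phi,\xi,\eta,g,\epsilon)$ is an $(\epsilon)$-almost para-contact metric structure. It is $(\epsilon)$-para-Sasakian if, with $\nabla$ the Levi-Civita connection of $g$, $(\nabla_X\phi)Y=-g(\phi X,\phi Y)\xi-\epsilon\,\eta(Y)\phi^2X$ for all $X,Y$. An $(\epsilon)$-para-Sasakian 3-manifold is a 3-dimensional manifold with such a structure. $R(X,Y)=[\nabla_X,\nabla_Y]-\nabla_{[X,Y]}$ is the curvature tensor and $S(Y,U)=\operatorname{trace}(X\mapsto R(X,Y)U)$ the Ricci tensor. For a scalar function $\psi$ on $M$, the $\mathcal{Z}$ tensor is the symmetric $(0,2)$-tensor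 $\mathcal{Z}(X,Y)=S(X,Y)+\psi\,g(X,Y)$. For a $(0,2)$-tensor $T$, $(R(X,Y)\cdot T)(U,V)=-T(R(X,Y)U,V)-T(U,R(X,Y)V)$. The manifold $M$ is: Einstein if $S=\lambda g$ for some constant $\lambda$; Ricci-symmetric if $\nabla S=0$; Ricci-semisymmetric if $R(X,Y)\cdot S=0$ for all $X,Y$; $\mathcal{Z}$-semisymmetric if $R(X,Y)\cdot\mathcal{Z}=0$ for all $X,Y$. *)

(* Defs.v *)
From HB Require Import structures.
From mathcomp Require Import all_boot all_order all_algebra.
From mathcomp Require Import sesquilinear ring.
From mathcomp Require Import all_classical all_reals all_analysis.

Set Implicit Arguments.
Unset Strict Implicit.
Unset Printing Implicit Defensive.

Import Order.TTheory GRing.Theory Num.Theory.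
Import numFieldNormedType.Exports.

Local Open Scope classical_set_scope.
Local Open Scope ring_scope.

Section smooth_maps.
Variables (R : realType) (n : nat).
Implicit Types (U : set 'rV[R]_n) (f g : 'rV[R]_n -> R).

Definition std_vec (i : 'I_n) : 'rV[R]_n := delta_mx 0 i.

(* All partial derivatives of f of order at most k exist and are continuous
   on U; U is always an open set below. *)
Fixpoint Ck (k : nat) U f : Prop :=
  (forall x, U x -> {for x, continuous f}) /\
  (if k is k'.+1 then
     forall i, (forall x, U x -> derivable f x (std_vec i)) /\
       Ck k' U (fun x => 'D_(std_vec i) f x)
   else True).

Definition smooth_on U f : Prop := forall k, Ck k U f.

Lemma Ck_eq k U f g : open U -> (forall x, U x -> f x = g x) ->
  Ck k U f -> Ck k U g.
Proof.
move=> oU; elim: k f g => [|k IH] f g fg /= [cf Hf];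
  have nfg x : U x -> \near x, f x = g x by
    move=> Ux; apply: filterS fg _; exact: open_nbhs_nbhs.
all: have cg x : U x -> {for x, continuous g} by
  move=> Ux; change (g @ x --> g x); rewrite -fg//;
  apply: (@cvg_trans _ (f @ x)); [exact: near_eq_cvg (nfg x Ux)|exact: cf].
  by [].
split=> // i; have [df Df] := Hf i; split.
  by move=> x Ux; apply: near_eq_derivable (df x Ux); exact: nfg.
by apply: IH Df => x Ux; apply: near_eq_derive; exact: nfg.
Qed.

Lemma Ck_cont k U f x : Ck k U f -> U x -> {for x, continuous f}.
Proof. by case: k => [|k] /= [cf _]; exact: cf. Qed.

Lemma CkW k U f : Ck k.+1 U f -> Ck k U f.
Proof.
elim: k f => [|k IH] f [cf Hf]; split=> // i; have [df Df] := Hf i.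
by split=> //; exact: IH.
Qed.

Lemma Ck_cst k U (a : R) : Ck k U (fun=> a).
Proof.
elim: k a => [|k IH] a; (split; first by move=> x _; exact: cst_continuous) => //.
move=> i; split; first by move=> x _; exact: derivable_cst.
by under eq_fun do rewrite derive_cst; exact: IH.
Qed.

Lemma CkD k U f g : open U -> Ck k U f -> Ck k U g -> Ck k U (f + g).
Proof.
move=> oU; elim: k f g => [|k IH] f g [cf Hf] [cg Hg];
  (split; first by move=> x Ux; apply: continuousD; [exact: cf|exact: cg]) => //.
move=> i; have [df Df] := Hf i; have [dg Dg] := Hg i; split.
  by move=> x Ux; apply: derivableD; [exact: df|exact: dg].
by apply: (Ck_eq oU _ (IH _ _ Df Dg)) => x Ux; rewrite deriveD; auto.
Qed.

Lemma CkM k U f g : open U -> Ck k U f -> Ck k U g -> Ck k U (f * g).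
Proof.
move=> oU; elim: k f g => [|k IH] f g Cf Cg; have [cf Hf] := Cf; have [cg Hg] := Cg;
  (split; first by move=> x Ux; apply: continuousM; [exact: cf|exact: cg]) => //.
move=> i; have [df Df] := Hf i; have [dg Dg] := Hg i; split.
  by move=> x Ux; apply: derivableM; [exact: df|exact: dg].
apply: (Ck_eq oU _ (CkD oU (IH _ _ (CkW Cf) Dg) (IH _ _ (CkW Cg) Df))).
by move=> x Ux; rewrite deriveM; auto.
Qed.

End smooth_maps.

(* Outside [cdom] (resp. [ccod]) the values of [cmap] (resp. [cinv]) are
   irrelevant. *)
Record chart (R : realType) (n : nat) (M : topologicalType) := Chart {
  cdom : set M;
  ccod : set 'rV[R]_n;
  cmap : M -> 'rV[R]_n;
  cinv : 'rV[R]_n -> M;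
  cdom_open : open cdom;
  ccod_open : open ccod;
  cmap_in : forall p, cdom p -> ccod (cmap p);
  cinv_in : forall x, ccod x -> cdom (cinv x);
  cmapK : forall p, cdom p -> cinv (cmap p) = p;
  cinvK : forall x, ccod x -> cmap (cinv x) = x;
  cmap_cont : forall p, cdom p -> {for p, continuous cmap};
  cinv_cont : forall x, ccod x -> {for x, continuous cinv} }.

Definition smooth_transition (R : realType) (n : nat) (M : topologicalType)
    (a b : chart R n M) : Prop :=
  forall j : 'I_n, smooth_on (ccod a `&` (cinv a @^-1` cdom b))
    (fun x => cmap b (cinv a x) 0 j).

Arguments cdom_open {R n M} c.
Arguments ccod_open {R n M} c.

(* Smooth functions only depend on the maximal atlas generated by [atlas], so
   maximality is not required. *)
Record manifold (R : realType) (n : nat) := Manifold {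
  mcarrier :> topologicalType;
  mhausdorff : hausdorff_space mcarrier;
  mcountable : @second_countable mcarrier;
  atlas : set (chart R n mcarrier);
  atlas_cover : forall p, exists2 c, atlas c & cdom c p;
  atlas_smooth : forall a b, atlas a -> atlas b -> smooth_transition a b }.

Section smooth_functions.
Variables (R : realType) (n : nat) (M : manifold R n).

Definition smooth_fun (f : M -> R) : Prop :=
  forall c, atlas c -> smooth_on (ccod c) (fun x => f (cinv c x)).

Definition smooth_pred : {pred M -> R} := fun f => `[< smooth_fun f >].

Lemma smooth_cst (a : R) : smooth_fun (fun=> a).
Proof. by move=> c _ k; exact: Ck_cst. Qed.

Lemma smoothD f g : smooth_fun f -> smooth_fun g -> smooth_fun (f + g).
Proof.
by move=> sf sg c ac k; exact: (CkD (ccod_open c) (sf c ac k) (sg c ac k)).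
Qed.

Lemma smoothM f g : smooth_fun f -> smooth_fun g -> smooth_fun (f * g).
Proof.
by move=> sf sg c ac k; exact: (CkM (ccod_open c) (sf c ac k) (sg c ac k)).
Qed.

Lemma smoothZ (a : R) f : smooth_fun f -> smooth_fun (a *: f).
Proof. by move=> sf; apply: (smoothM (smooth_cst a) sf). Qed.

Lemma smooth_subring : subring_closed smooth_pred.
Proof.
split=> [|f g /asboolP sf /asboolP sg|f g /asboolP sf /asboolP sg];
  apply/asboolP; first exact: smooth_cst.
- rewrite -scaleN1r; exact: smoothD sf (smoothZ _ sg).
- exact: smoothM.
Qed.

Lemma smooth_submod : subsemimod_closed smooth_pred.
Proof.
split; first split.
- by apply/asboolP; exact: smooth_cst.
- by move=> f g /asboolP sf /asboolP sg; apply/asboolP; exact: smoothD.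
- by move=> a f /asboolP sf; apply/asboolP; exact: smoothZ.
Qed.

Record sfun := SFun { sfun_val :> M -> R; _ : sfun_val \in smooth_pred }.

HB.instance Definition _ := [isSub for sfun_val].
HB.instance Definition _ := [Choice of sfun by <:].
HB.instance Definition _ :=
  GRing.SubChoice_isSubComPzRing.Build _ _ sfun smooth_subring.
HB.instance Definition _ :=
  GRing.SubZmodule_isSubLmodule.Build R _ _ sfun smooth_submod.

Definition mk_sfun (f : M -> R) (sf : smooth_fun f) : sfun :=
  @SFun f (introT (asboolP _) sf).

Lemma sfunP (f : sfun) : smooth_fun f.
Proof. by have /asboolP := valP f. Qed.

End smooth_functions.

Section tangent_fields.
Variables (R : realType) (n : nat) (M : manifold R n).
Local Notation F := (sfun M).

Definition derivation_at (p : M) (v : F -> R) : Prop :=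
  (forall (a : R) (f h : F), v (a *: f + h) = a * v f + v h) /\
  (forall f h : F, v (f * h) = f p * v h + h p * v f).

Definition tangent_pred (p : M) : {pred F -> R} :=
  fun v => `[< derivation_at p v >].

Lemma tangent_submod p : subsemimod_closed (tangent_pred p).
Proof.
split; first split.
- by apply/asboolP; split=> [a f h|f h]; rewrite !mulr0 addr0.
- move=> v w /asboolP[vL vM] /asboolP[wL wM]; apply/asboolP; split=> [a f h|f h].
    by rewrite !fctE vL wL mulrDr addrACA.
  by rewrite !fctE vM wM !mulrDr addrACA.
- move=> b v /asboolP[vL vM]; apply/asboolP; split=> [a f h|f h].
    by rewrite !fctE vL /GRing.scale/= mulrDr mulrCA.
  by rewrite !fctE vM /GRing.scale/= mulrDr; congr (_ + _); rewrite mulrCA.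
Qed.

(* Tangent vectors at p are the point derivations of C^oo(M) at p. *)
Record tangent (p : M) := Tangent { tangent_val :> F -> R; _ : tangent_val \in tangent_pred p }.

HB.instance Definition _ p := [isSub for @tangent_val p].
HB.instance Definition _ p := [Choice of tangent p by <:].
HB.instance Definition _ p :=
  GRing.SubChoice_isSubLmodule.Build R _ _ (tangent p) (tangent_submod p).

Definition derivation (X : F -> F^o) : Prop :=
  (forall (a : R) (f h : F), X (a *: f + h) = a *: (X f : F) + X h) /\
  (forall f h : F, X (f * h) = f * X h + h * X f).

Definition vfield_pred : {pred F -> F^o} := fun X => `[< derivation X >].

Lemma vfield_submod : subsemimod_closed vfield_pred.
Proof.
split; first split.
- by apply/asboolP; split=> [a f h|f h]; rewrite ?mulr0 ?scaler0 addr0.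
- move=> X Y /asboolP[XL XM] /asboolP[YL YM]; apply/asboolP; split=> [a f h|f h].
    by rewrite !fctE XL YL scalerDr addrACA.
  by rewrite !fctE XM YM !mulrDr addrACA.
- move=> b X /asboolP[XL XM]; apply/asboolP; split=> [a f h|f h].
    rewrite !fctE XL /GRing.scale/= mulrDr; congr (_ + _).
    by apply/val_inj/funext => p /=; rewrite !fctE mulrCA.
  by rewrite !fctE XM /GRing.scale/= mulrDr; congr (_ + _); rewrite mulrCA.
Qed.

(* Vector fields are the derivations of the algebra C^oo(M); they form a
   C^oo(M)-module, whence the regular module F^o. *)
Record vfield := VField { vf_val :> F -> F^o; _ : vf_val \in vfield_pred }.

HB.instance Definition _ := [isSub for vf_val].
HB.instance Definition _ := [Choice of vfield by <:].
HB.instance Definition _ :=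
  GRing.SubChoice_isSubLmodule.Build F _ _ vfield vfield_submod.

Lemma vfieldP (X : vfield) : derivation X.
Proof. by have /asboolP := valP X. Qed.

Definition mk_vfield (X : F -> F) (dX : derivation X) : vfield :=
  @VField X (introT (asboolP _) dX).

Lemma vat_subproof (X : vfield) p : (fun f => (X f : F) p) \in tangent_pred p.
Proof.
have [XL XM] := vfieldP X; apply/asboolP; split=> [a f h|f h].
  by rewrite XL.
by rewrite XM.
Qed.

(* X_p *)
Definition vat (X : vfield) (p : M) : tangent p := Tangent (vat_subproof X p).

Lemma bracket_subproof (X Y : vfield) :
  derivation (fun f => X (Y f) - Y (X f) : F).
Proof.
have [XL XM] := vfieldP X; have [YL YM] := vfieldP Y; split=> [a f h|f h].
  by rewrite YL XL XL YL opprD addrACA scalerBr.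
have XD u v : X (u + v) = X u + X v by have := XL 1 u v; rewrite !scale1r.
have YD u v : Y (u + v) = Y u + Y v by have := YL 1 u v; rewrite !scale1r.
rewrite YM XM XD YD !XM !YM; apply/val_inj/funext => p /=; rewrite !fctE.
ring.
Qed.

Definition bracket (X Y : vfield) : vfield := mk_vfield (bracket_subproof X Y).

(* A tensor field is a family of multilinear maps on the tangent spaces which
   sends smooth vector fields to smooth functions or vector fields. *)
Record oneform := OneForm {
  of_val :> forall p : M, {scalar tangent p};
  of_smooth : forall X : vfield, smooth_fun (fun p => of_val p (vat X p)) }.

Record tensor11 := Tensor11 {
  t11_val :> forall p : M, {linear tangent p -> tangent p};
  t11_smooth : forall (X : vfield) (f : F),
    smooth_fun (fun p => t11_val p (vat X p) f) }.

Record tensor02 := Tensor02 {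
  t02_val :> forall p : M, {biscalar tangent p};
  t02_smooth : forall X Y : vfield,
    smooth_fun (fun p => t02_val p (vat X p) (vat Y p)) }.

(* T(X, Y) *)
Definition t02_app (T : tensor02) (X Y : vfield) : F := mk_sfun (t02_smooth T X Y).

Lemma t11_app_subproof (T : tensor11) (X : vfield) :
  derivation (fun f => mk_sfun (t11_smooth T X f)).
Proof.
split=> [a f h|f h]; apply/val_inj/funext => p /=; rewrite !fctE;
  have /asboolP[vL vM] := valP (T p (vat X p)); [exact: vL|exact: vM].
Qed.

Definition t11_app (T : tensor11) (X : vfield) : vfield :=
  mk_vfield (t11_app_subproof T X).

(* b has index nu: nu is the largest dimension of a subspace on which b is
   negative definite, the subspace being given by a spanning family; the
   condition makes the family linearly independent. *)
Definition neg_definite_family (V : lmodType R) (b : V -> V -> R) (k : nat)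
    (e : 'I_k -> V) : Prop :=
  forall c : 'rV[R]_k, c != 0 ->
    b (\sum_i c 0 i *: e i) (\sum_i c 0 i *: e i) < 0.

Definition has_index (V : lmodType R) (b : V -> V -> R) (nu : nat) : Prop :=
  (exists e : 'I_nu -> V, neg_definite_family b e) /\
  (forall (k : nat) (e : 'I_k -> V), neg_definite_family b e -> (k <= nu)%N).

(* Semi-Riemannian metric: symmetric, nondegenerate, of constant index. *)
Definition semi_riemannian (g : tensor02) : Prop :=
  [/\ forall p (u v : tangent p), g p u v = g p v u,
      forall p (u : tangent p), (forall v, g p u v = 0) -> u = 0 &
      exists nu, forall p, has_index (g p) nu].

(* Affine connection; [nabla X Y] is the covariant derivative of Y along X. *)
Definition connection (nabla : vfield -> vfield -> vfield) : Prop :=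
  [/\ forall (f : F) (X Y Z : vfield),
        nabla (f *: X + Y) Z = f *: nabla X Z + nabla Y Z,
      forall X Y Z : vfield, nabla X (Y + Z) = nabla X Y + nabla X Z &
      forall (f : F) (X Y : vfield),
        nabla X (f *: Y) = (X f : F) *: Y + f *: nabla X Y].

Definition levi_civita (g : tensor02) (nabla : vfield -> vfield -> vfield) :
    Prop :=
  [/\ connection nabla,
      forall X Y : vfield, nabla X Y - nabla Y X = bracket X Y &
      forall X Y Z : vfield, X (t02_app g Y Z) =
        t02_app g (nabla X Y) Z + t02_app g Y (nabla X Z)].

Section curvature.
Variable nabla : vfield -> vfield -> vfield.

Definition curvature (X Y U : vfield) : vfield :=
  nabla X (nabla Y U) - nabla Y (nabla X U) - nabla (bracket X Y) U.

Definition tangent_basis (p : M) (e : 'I_n -> tangent p) : Prop :=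
  forall v : tangent p, exists! c : 'rV[R]_n, v = \sum_i c 0 i *: e i.

(* S is the Ricci tensor: at each point p, S(Y, U) is the trace of
   X |-> R(X, Y)U, read off the matrix A of this endomorphism of T_p M in a
   basis of T_p M; the basis vectors are values at p of vector fields so that
   R can be applied to them. The trace does not depend on the basis. *)
Definition is_ricci (S : tensor02) : Prop :=
  forall (p : M) (Y U : vfield),
    exists (E : 'I_n -> vfield) (A : 'M[R]_n),
      [/\ tangent_basis (fun i => vat (E i) p),
          forall j, vat (curvature (E j) Y U) p =
            \sum_i A i j *: vat (E i) p &
          S p (vat Y p) (vat U p) = \tr A].

(* (R(X, Y) . T)(U, V) at p. *)
Definition curvature_act (T : forall p : M, {biscalar tangent p})
    (X Y U V : vfield) (p : M) : R :=
  - T p (vat (curvature X Y U) p) (vat V p)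
  - T p (vat U p) (vat (curvature X Y V) p).

Definition semisymmetric (T : forall p : M, {biscalar tangent p}) : Prop :=
  forall (X Y U V : vfield) (p : M), curvature_act T X Y U V p = 0.

Definition cov_deriv02 (T : tensor02) (X Y Z : vfield) : F :=
  (X (t02_app T Y Z) : F) - t02_app T (nabla X Y) Z - t02_app T Y (nabla X Z).

Definition parallel02 (T : tensor02) : Prop :=
  forall X Y Z : vfield, cov_deriv02 T X Y Z = 0.

End curvature.

Definition einstein (g S : tensor02) : Prop :=
  exists lambda : R, forall (p : M) (u v : tangent p), S p u v = lambda * g p u v.

Section ztensor.
Variables (S g : tensor02) (psi : M -> R).

Definition ztensor_fun (p : M) (u v : tangent p) : R :=
  S p u v + psi p * g p u v.

Lemma ztensor_bilinear p : bilinear_for *%R *%R (@ztensor_fun p).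
Proof.
split=> w a u v; rewrite /ztensor_fun.
  by rewrite !linearPl/= /GRing.scale/=; ring.
by rewrite !linearPr/= /GRing.scale/=; ring.
Qed.

HB.instance Definition _ p := bilinear_isBilinear.Build R (tangent p) (tangent p) R
  *%R *%R (@ztensor_fun p) (@ztensor_bilinear p).

(* psi may be any function; when it is smooth so is Z, by [ztensor_smooth]. *)
Definition ztensor (p : M) : {biscalar tangent p} := @ztensor_fun p.

Lemma ztensor_smooth (X Y : vfield) : smooth_fun psi ->
  smooth_fun (fun p => ztensor p (vat X p) (vat Y p)).
Proof.
by move=> spsi; exact: smoothD (t02_smooth S X Y)
  (smoothM spsi (t02_smooth g X Y)).
Qed.

End ztensor.

Section para_sasakian.
Variables (phi : tensor11) (xi : vfield) (eta : oneform).
Variables (g : tensor02) (eps : R).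

Definition almost_para_contact : Prop :=
  [/\ forall p (u : tangent p), phi p (phi p u) = u - eta p u *: vat xi p,
      forall p, eta p (vat xi p) = 1,
      forall p, phi p (vat xi p) = 0 &
      forall p (u : tangent p), eta p (phi p u) = 0].

Definition eps_almost_para_contact_metric : Prop :=
  [/\ almost_para_contact, semi_riemannian g, eps = 1 \/ eps = -1 &
      forall p (u v : tangent p),
        g p (phi p u) (phi p v) = g p u v - eps * (eta p u * eta p v)].

(* (nabla_X phi) Y *)
Definition cov_deriv11 (nabla : vfield -> vfield -> vfield) (T : tensor11)
    (X Y : vfield) : vfield :=
  nabla X (t11_app T Y) - t11_app T (nabla X Y).

(* [nabla] is meant to be the Levi-Civita connection of g. *)
Definition eps_para_sasakian (nabla : vfield -> vfield -> vfield) : Prop :=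
  eps_almost_para_contact_metric /\
  forall (X Y : vfield) (p : M),
    vat (cov_deriv11 nabla phi X Y) p =
      - g p (phi p (vat X p)) (phi p (vat Y p)) *: vat xi p
      - (eps * eta p (vat Y p)) *: phi p (phi p (vat X p)).

End para_sasakian.

End tangent_fields.

(* Main.v *)
Require Import Defs.
From mathcomp Require Import all_boot all_order all_algebra.
From mathcomp Require Import all_classical all_reals all_analysis.
From mathcomp Require Import ring lra.

Import GRing.Theory.

Local Open Scope ring_scope.

(** On an epsilon-para-Sasakian manifold of dimension n the structure equation
    determines the curvature in the direction of xi. Applied to Y = xi it gives
    nabla_X xi = eps phi X ([nabla_xi]), and differentiating once more
    R(X, Y) xi = eta(X) Y - eta(Y) X ([curvature_xi]). Tracing over X,
    S(Y, xi) = (1 - n) eta(Y) ([ricci_eigenvector]).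

    These values turn semisymmetry into the Einstein equation
    ([semisymmetric_ricci_eq]). Indeed (R(xi, Y) . S)(U, xi) = 0 reads
      S(R(xi, Y) U, xi) + S(U, R(xi, Y) xi) = 0.
    The first term is (1 - n) eta(R(xi, Y) U), which is known because the
    metric is itself semisymmetric: R is skew for g, so that
    eta(R(xi, Y) U) = eps g(R(xi, Y) U, xi) = - eps g(U, R(xi, Y) xi). In the
    second term R(xi, Y) xi = Y - eta(Y) xi, whence S(U, Y) up to known terms.
    What is left is S = (1 - n) eps g, that is S = - 2 eps g for n = 3.

    The other implications hold for any metric. An Einstein Ricci tensor is a
    constant multiple of the parallel tensor g; a parallel tensor is killed by
    all [nabla_X, nabla_Y] - nabla_[X, Y] ([parallel_semisymmetric]); and Z
    differs from S by a pointwise multiple of g, on which R acts trivially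
    ([semisymmetric_ztensor]). As R(X, Y) acts pointwise, the function psi may
    be arbitrary. *)

(** * Vector fields and their values at a point *)

Section fields.
Context {R : realType} {n : nat} {M : manifold R n}.
Local Notation F := (Defs.sfun M).
Implicit Types (X Y Z U V : vfield M) (p : M) (T g S : tensor02 M).

Definition constf (a : R) : F := mk_sfun (smooth_cst (M := M) a).

Lemma vfD X (f h : F) : (X (f + h) : F) = X f + X h.
Proof. by have [XL _] := vfieldP X; have := XL 1 f h; rewrite !scale1r. Qed.

Lemma vf0 X : (X 0 : F) = 0.
Proof. by apply: (addrI (X 0 : F)); rewrite -vfD !addr0. Qed.

Lemma vfZ X (a : R) (f : F) : (X (a *: f) : F) = a *: (X f : F).
Proof.
by have [XL _] := vfieldP X; rewrite -[a *: f]addr0 XL vf0 addr0.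
Qed.

Lemma vf_constf X (a : R) : (X (constf a) : F) = 0.
Proof.
have [_ XM] := vfieldP X.
have X1 : (X 1 : F) = 0.
  by apply: (addrI (X 1 : F)); rewrite addr0 -{3}[1]mulr1 XM !mul1r.
have -> : constf a = a *: (1 : F).
  by apply/val_inj/funext => p /=; rewrite !fctE /GRing.scale/= mulr1.
by rewrite vfZ X1 scaler0.
Qed.

Lemma vfield_ext X Y : (forall p, vat X p = vat Y p) -> X = Y.
Proof.
move=> XY; apply/val_inj/funext => f; apply/val_inj/funext => p.
exact: (congr1 (fun v : tangent p => v f) (XY p)).
Qed.

Lemma vatD X Y p : vat (X + Y) p = vat X p + vat Y p.
Proof. exact/val_inj. Qed.

Lemma vatB X Y p : vat (X - Y) p = vat X p - vat Y p.
Proof. exact/val_inj. Qed.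

Lemma vatZ (f : F) X p : vat (f *: X) p = f p *: vat X p.
Proof. exact/val_inj. Qed.

Lemma vat_t11 (T : tensor11 M) X p : vat (t11_app T X) p = T p (vat X p).
Proof. exact/val_inj. Qed.

(** Tangent vectors extend to global vector fields at any point where some
    vector fields form a basis; no bump function is involved, since the
    coefficients are constant. *)
Lemma tangent_basis_vat {p} {E : 'I_n -> vfield M} (v : tangent p) :
  tangent_basis (fun i => vat (E i) p) -> exists X, v = vat X p.
Proof.
move=> /(_ v)[c [-> _]]; exists (\sum_i constf (c 0 i) *: E i).
rewrite (big_morph (fun X => vat X p) (fun X Y => vatD X Y p) (id1 := 0)).
  by apply: eq_bigr => i _; rewrite vatZ.
exact/val_inj.
Qed.

(** * Parallel, semisymmetric and Einstein tensors *)

(** The Ricci identity: when T is parallel, both sides of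
    [X, Y] T(U, V) = X Y T(U, V) - Y X T(U, V) expand by the Leibniz rule, and
    the mixed terms T(nabla_X U, nabla_Y V) cancel. *)
Lemma parallel_semisymmetric nabla T :
  parallel02 nabla T -> semisymmetric nabla T.
Proof.
move=> nT X Y U V p.
have H X' Y' Z' : (X' (t02_app T Y' Z') : F) =
    t02_app T (nabla X' Y') Z' + t02_app T Y' (nabla X' Z').
  by have /eqP := nT X' Y' Z'; rewrite /cov_deriv02 -addrA -opprD subr_eq0 => /eqP.
have e : (bracket X Y (t02_app T U V) : F) =
  X (Y (t02_app T U V)) - Y (X (t02_app T U V)) by [].
move: e; rewrite !H !vfD !H => /(congr1 (fun f : F => f p)) /=.
rewrite !fctE /= /curvature_act /curvature !vatB !linearBl !linearBr /=.
lra.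
Qed.

Lemma einstein_parallel nabla g S :
  levi_civita g nabla -> einstein g S -> parallel02 nabla S.
Proof.
move=> [_ _ ng] [a Sg] X Y Z.
have Sag Y' Z' : t02_app S Y' Z' = a *: t02_app g Y' Z'.
  by apply/val_inj/funext => p /=; rewrite Sg.
by rewrite /cov_deriv02 !Sag vfZ ng -addrA -opprD -!scalerDr subrr.
Qed.

Lemma curvature_act_ztensor nabla S g psi X Y U V p :
  curvature_act nabla (ztensor S g psi) X Y U V p =
  curvature_act nabla S X Y U V p + psi p * curvature_act nabla g X Y U V p.
Proof. rewrite /curvature_act /ztensor /= /ztensor_fun; ring. Qed.

Lemma levi_civita_semisymmetric g nabla :
  levi_civita g nabla -> semisymmetric nabla g.
Proof.
move=> [_ _ ng]; apply: parallel_semisymmetric => X Y Z.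
by rewrite /cov_deriv02 ng -addrA -opprD subrr.
Qed.

Lemma semisymmetric_ztensor nabla S g psi : levi_civita g nabla ->
  semisymmetric nabla (ztensor S g psi) <-> semisymmetric nabla S.
Proof.
move=> /levi_civita_semisymmetric ng.
have act X Y U V p : curvature_act nabla (ztensor S g psi) X Y U V p =
    curvature_act nabla S X Y U V p.
  by rewrite curvature_act_ztensor ng mulr0 addr0.
by split=> H X Y U V p; have := H X Y U V p; rewrite act.
Qed.

(** The endomorphism X |-> zeta(X) Y - zeta(Y) X is the difference of a rank one
    map of trace zeta(Y) and of zeta(Y) times the identity. *)
Lemma ricci_eigenvector nabla S (zeta : oneform M) V p Y :
  is_ricci nabla S ->
  (forall X, vat (curvature nabla X Y V) p =
     zeta p (vat X p) *: vat Y p - zeta p (vat Y p) *: vat X p) ->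
  S p (vat Y p) (vat V p) = (1 - n%:R) * zeta p (vat Y p).
Proof.
move=> /(_ p Y V)[E [A [basE RA ->]]] curvV.
have [y [defY _]] := basE (vat Y p).
have Aij i j : A i j =
    zeta p (vat (E j) p) * y 0 i - zeta p (vat Y p) * (i == j)%:R.
  have [c [_ uniq_c]] := basE (vat (curvature nabla (E j) Y V) p).
  have cA : c = \row_k A k j.
    by apply: uniq_c; rewrite RA; apply: eq_bigr => k _; rewrite mxE.
  have -> : A i j = c 0 i by rewrite cA mxE.
  have -> : c = \row_k (zeta p (vat (E j) p) * y 0 k
                        - zeta p (vat Y p) * (k == j)%:R); last by rewrite mxE.
  apply: uniq_c; rewrite curvV {1}defY scaler_sumr.
  under [RHS]eq_bigr do rewrite mxE scalerBl -!scalerA.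
  rewrite sumrB; congr (_ - _); rewrite (bigD1 j) //= eqxx scale1r big1 ?addr0 //.
  by move=> k /negPf ->; rewrite scale0r scaler0.
rewrite /mxtrace; under eq_bigr do rewrite Aij eqxx mulr1.
rewrite sumrB sumr_const card_ord mulrBl mul1r mulr_natl; congr (_ - _).
rewrite defY linear_sum; apply: eq_bigr => i _.
by rewrite linearZ /= mulrC.
Qed.

End fields.

(** * Curvature of para-Sasakian manifolds *)

Section para_sasakian_curvature.
Context {R : realType} {n : nat} {M : manifold R n}.
Context {phi : tensor11 M} {xi : vfield M} {eta : oneform M}.
Context {g : tensor02 M} {eps : R}.
Context {nabla : vfield M -> vfield M -> vfield M}.
Hypothesis h_nabla : levi_civita g nabla.
Hypothesis h_sasakian : eps_para_sasakian phi xi eta g eps nabla.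
Local Notation F := (Defs.sfun M).
Implicit Types (X Y U V : vfield M) (p : M).

Lemma eps_sq : eps * eps = 1.
Proof.
by have [[_ _ [] -> _] _] := h_sasakian; rewrite ?mulrNN mulr1.
Qed.

Lemma metric_xi p (u : tangent p) : g p u (vat xi p) = eps * eta p u.
Proof.
have [[[_ eta_xi phi_xi _] _ _ g_phi] _] := h_sasakian.
have := g_phi p u (vat xi p).
by rewrite phi_xi linear0r eta_xi mulr1 => /esym/eqP; rewrite subr_eq0 => /eqP.
Qed.

Lemma metric_xil p (u : tangent p) : g p (vat xi p) u = eps * eta p u.
Proof.
by have [[_ [g_sym _ _] _ _] _] := h_sasakian; rewrite g_sym metric_xi.
Qed.

(** Since g(xi, xi) = eps is constant, nabla_X xi is orthogonal to xi. *)
Lemma eta_nabla_xi X p : eta p (vat (nabla X xi) p) = 0.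
Proof.
have [_ _ ng] := h_nabla.
have [[[_ eta_xi _ _] _ _ _] _] := h_sasakian.
have g_xi : t02_app g xi xi = constf eps.
  by apply/val_inj/funext => q /=; rewrite metric_xi eta_xi mulr1.
have := ng X xi xi; rewrite g_xi vf_constf => /(congr1 (fun f : F => f p)) /=.
rewrite !fctE /= metric_xi metric_xil -[0 p]/(0 : R) => e.
have e0 : eps * eta p (vat (nabla X xi) p) = 0 by lra.
by rewrite -[LHS]mul1r -eps_sq -mulrA e0 mulr0.
Qed.

(** As phi xi = 0, the structure equation at Y = xi is
    - phi (nabla_X xi) = - eps phi^2 X. Applying phi recovers nabla_X xi, which
    has no component along xi, and phi^3 = phi. *)
Lemma nabla_xi X : nabla X xi = constf eps *: t11_app phi X.
Proof.
have [[[phi2 eta_xi phi_xi eta_phi] _ _ _] dphi] := h_sasakian.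
have [[_ nD _] _ _] := h_nabla.
have nabla0 : nabla X 0 = 0.
  by apply: (addrI (nabla X 0)); rewrite -nD !addr0.
have phi_xi0 : t11_app phi xi = 0.
  by apply: vfield_ext => p; rewrite vat_t11 phi_xi; exact/val_inj.
apply: vfield_ext => p; rewrite vatZ vat_t11 /=.
have phi3 (u : tangent p) : phi p (phi p (phi p u)) = phi p u.
  by rewrite phi2 eta_phi scale0r subr0.
have := dphi X xi p.
rewrite /cov_deriv11 phi_xi0 nabla0 vatB vat_t11 phi_xi linear0r oppr0 scale0r.
rewrite eta_xi mulr1.
have -> : vat (0 : vfield M) p = 0 by exact/val_inj.
rewrite !sub0r => /oppr_inj /(congr1 (phi p)).
by rewrite phi2 eta_nabla_xi scale0r subr0 linearZ /= phi3.
Qed.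

(** With nabla xi = eps phi and zero torsion, R(X, Y) xi is
    eps ((nabla_X phi) Y - (nabla_Y phi) X); in the structure equation the
    component along xi is symmetric in X and Y, hence cancels. *)
Lemma curvature_xi X Y p : vat (curvature nabla X Y xi) p =
  eta p (vat X p) *: vat Y p - eta p (vat Y p) *: vat X p.
Proof.
have [[[phi2 _ _ _] [g_sym _ _] _ _] dphi] := h_sasakian.
have [[_ _ nZ] torsion _] := h_nabla.
rewrite /curvature !nabla_xi !nZ !vf_constf !scale0r !add0r -torsion.
rewrite !vatB !vatZ !vat_t11 !vatB !linearB /=.
have := dphi Y X p; have := dphi X Y p.
rewrite /cov_deriv11 !vatB !vat_t11 (g_sym p (phi p (vat Y p))) !phi2.
move=> /eqP; rewrite subr_eq => /eqP -> /eqP; rewrite subr_eq => /eqP ->.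
apply/val_inj/funext => f /=; rewrite !fctE /GRing.scale /=.
ring: eps_sq.
Qed.

Lemma semisymmetric_ricci_eq S : is_ricci nabla S -> semisymmetric nabla S ->
  forall p (u v : tangent p), S p u v = (1 - n%:R) * eps * g p u v.
Proof.
move=> ricS RS p u v.
have [[[_ eta_xi _ _] _ _ _] _] := h_sasakian.
have S_xi Y : S p (vat Y p) (vat xi p) = (1 - n%:R) * eta p (vat Y p).
  by apply: ricci_eigenvector ricS _ => X; exact: curvature_xi.
have [E [A [basE _ _]]] := ricS p xi xi.
have [U ->] := tangent_basis_vat u basE; have [Y ->] := tangent_basis_vat v basE.
(* Skewness of R(xi, Y) gives the xi-component of R(xi, Y) U. *)
have := levi_civita_semisymmetric _ _ h_nabla xi Y U xi p.
have := RS xi Y U xi p.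
rewrite /curvature_act S_xi metric_xi curvature_xi eta_xi scale1r.
rewrite !linearBr !linearZr /= S_xi metric_xi.
move=> eS eg.
have eta_R : eta p (vat (curvature nabla xi Y U) p) =
    eta p (vat U p) * eta p (vat Y p) - eps * g p (vat U p) (vat Y p).
  rewrite -[LHS]mul1r -eps_sq -mulrA.
  have -> : eps * eta p (vat (curvature nabla xi Y U) p) =
      eps * eta p (vat U p) * eta p (vat Y p) - g p (vat U p) (vat Y p) by lra.
  ring: eps_sq.
move: eS; rewrite eta_R; lra.
Qed.

End para_sasakian_curvature.

Theorem corollary1 (R : realType) (M : manifold R 3)
    (phi : tensor11 M) (xi : vfield M) (eta : oneform M) (g : tensor02 M)
    (eps : R) (nabla : vfield M -> vfield M -> vfield M) (S : tensor02 M)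
    (psi : M -> R)
    (h_nabla : levi_civita g nabla)
    (h_sasakian : eps_para_sasakian phi xi eta g eps nabla)
    (h_ricci : is_ricci nabla S) :
  [<-> einstein g S;
       parallel02 nabla S;
       semisymmetric nabla S;
       semisymmetric nabla (ztensor S g psi)].
Proof.
tfae.
- exact: einstein_parallel.
- exact: parallel_semisymmetric.
- exact: (semisymmetric_ztensor nabla S g psi h_nabla).2.
- move=> /((semisymmetric_ztensor nabla S g psi h_nabla).1) RS.
  exists ((1 - 3%:R) * eps).
  exact: (semisymmetric_ricci_eq h_nabla h_sasakian S h_ricci RS).
Qed.
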